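(* Let $\alpha$ be a partition with all parts $\ge2$, let $\pi$ be a permutation of $\{1,\dots,\ell(\alpha)\}$, let $\alpha_\pi$ be the corresponding rearrangement of the entries of $\alpha$, and let $R_{\alpha_\pi}$ be the connected ribbon with overlapping partition $p^\pi$. Let $\nu\in[\alpha,(|\alpha|-\ell(\alpha)+1,\ell(\alpha)-1)]$. If $c^\nu_{R_{\alpha_\pi}}>0$, then $$\nu_i\le\sum_{q=i}^{\ell(\alpha)}\alpha_q-p^\pi_i\quad\text{for }1\le i\le\ell(p^\pi).$$
   Context: A ribbon is a skew Young diagram (English convention) with no $2\times2$ square. For a composition $\beta$ with parts $\ge2$, the connected ribbon $R_\beta$ has rows from top to bottom of lengths $\beta_1,\dots,\beta_{\ell(\beta)}$, each pair of consecutive rows sharing exactly one column. Rows are ranked by length, ties being broken so that a lower row counts as smaller. The overlapping partition $p=(p_1,\dots,p_{\ell(\beta)-1},0)$ of $R_\beta$ has $p_i$ equal to the number of columns of length two both of whose boxes lie among the $\ell(\beta)-i+1$ smallest rows; $\ell(p)$ is its number of nonzero parts. For a skew shape $A$, $s_A=\sum_\nu c^\nu_As_\nu$ (Littlewood–Richardson coefficients). $[\lambda,\mu]$ is the interval in dominance order. *)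

(* Defs.v *)
From HB Require Import structures.
From mathcomp Require Import all_boot all_order all_fingroup all_algebra.
From mathcomp.multinomials Require Import mpoly.

Set Implicit Arguments.
Unset Strict Implicit.
Unset Printing Implicit Defensive.

Import GRing.Theory.

(* A partition is the weakly decreasing sequence of its positive parts. Parts, *)
(* rows, columns and tableau entries are indexed from 0; [nth 0 la i] is the   *)
(* (i+1)-st part, equal to 0 beyond the length.                                *)
Definition is_part (la : seq nat) : bool := sorted geq la && (0 \notin la).

(* The partitions of n with all parts <= m, grouped by the multiplicity k of   *)
(* the part m.                                                                 *)
Fixpoint partitions_le (m n : nat) : seq (seq nat) :=
  if m is m'.+1 then
    [seq nseq k m ++ la | k <- iota 0 (n %/ m).+1,
                          la <- partitions_le m' (n - k * m)]
  else if n == 0 then [:: [::]] else [::].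

Definition partitions (n : nat) : seq (seq nat) := partitions_le n n.

Definition dominates (mu la : seq nat) : Prop :=
  sumn la = sumn mu /\ forall k, sumn (take k la) <= sumn (take k mu).

Definition dom_interval (la mu nu : seq nat) : Prop :=
  [/\ is_part nu, dominates nu la & dominates mu nu].

(* English convention: the box (i, j) is in row i, counted from the top, and   *)
(* column j.                                                                   *)
Definition skew_diagram (la mu : seq nat) : seq (nat * nat) :=
  [seq (i, j) | i <- iota 0 (size la),
                j <- iota (nth 0 mu i) (nth 0 la i - nth 0 mu i)].

Definition young_diagram (la : seq nat) : seq (nat * nat) :=
  skew_diagram la [::].

Definition semistandard (n : nat) (D : seq (nat * nat))
    (T : {ffun seq_sub D -> 'I_n}) : bool :=
  [forall b, forall b',
    (((val b).1 == (val b').1) && ((val b).2 < (val b').2) ==> (T b <= T b'))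
    && (((val b).2 == (val b').2) && ((val b).1 < (val b').1)
         ==> (T b < T b'))].

(* The Schur function of the diagram D in n variables, with coefficients in    *)
(* the integers.                                                               *)
Definition schur (n : nat) (D : seq (nat * nat)) : {mpoly int[n]} :=
  (\sum_(T : {ffun seq_sub D -> 'I_n} | semistandard T)
     \prod_(b : seq_sub D) 'X_(T b))%R.

(* s_D = \sum_nu c nu s_nu as symmetric functions, i.e., in any number of      *)
(* variables. As the s_nu are linearly independent once n >= size D, this      *)
(* determines c on the partitions of size D.                                   *)
Definition LR_coefficients (D : seq (nat * nat)) (c : seq nat -> int) : Prop :=
  forall n : nat,
    (schur n D
     = \sum_(nu <- partitions (size D)) c nu *: schur n (young_diagram nu))%R.

(* Row i of the ribbon ends where the rows i, i+1, ... stacked with one-column *)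
(* overlaps end; row i starts in the last column of row i+1.                   *)
Definition ribbon_outer (be : seq nat) : seq nat :=
  [seq sumn (drop i be) - (size be - i.+1) | i <- iota 0 (size be)].

Definition ribbon_inner (be : seq nat) : seq nat :=
  [seq x.-1 | x <- behead (ribbon_outer be)].

Definition ribbon (be : seq nat) : seq (nat * nat) :=
  skew_diagram (ribbon_outer be) (ribbon_inner be).

Definition row_smaller (be : seq nat) (i k : nat) : bool :=
  (nth 0 be i < nth 0 be k) || ((nth 0 be i == nth 0 be k) && (k < i)).

Definition among_smallest (be : seq nat) (m i : nat) : bool :=
  count (fun k => row_smaller be k i) (iota 0 (size be)) < m.

Definition column (D : seq (nat * nat)) (j : nat) : seq (nat * nat) :=
  [seq b <- D | b.2 == j].

(* With i counted from 0, the size be - i smallest rows are the                *)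
(* l(be) - (i + 1) + 1 of the usual definition. The last entry is always 0.    *)
Definition overlapping_partition (be : seq nat) : seq nat :=
  [seq count (fun j => (size (column (ribbon be) j) == 2)
                && all (fun b => among_smallest be (size be - i) b.1)
                       (column (ribbon be) j))
             (undup [seq b.2 | b <- ribbon be])
  | i <- iota 0 (size be)].

Definition plength (p : seq nat) : nat := count (fun x => 0 < x) p.

Definition rearrange (al : seq nat) (pi : 'S_(size al)) : seq nat :=
  [seq nth 0 al (pi i) | i <- enum 'I_(size al)].
Arguments rearrange : clear implicits.

Lemma mem_partitions_le m n la :
  (la \in partitions_le m n)
  = [&& is_part la, all (fun x => x <= m) la & sumn la == n].
Proof.
elim: m n la => [|m IHm] n la.
  rewrite /=; case: la => [|x la] /=; first by case: n.
  rewrite /is_part /= in_cons negb_or.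
  by case: x => [|x]; case: n => [|n] //=; rewrite andbF.
apply/idP/idP.
  case/allpairsPdep => k [mu [+ + ->]].
  rewrite mem_iota add0n ltnS IHm leq_divRL // => kle.
  case/and3P => /andP [srt n0] /allP mule /eqP smu.
  apply/and3P; split.
  - apply/andP; split; last first.
      by rewrite mem_cat negb_or n0 andbT mem_nseq andbC.
    rewrite (sorted_pairwise (rev_trans leq_trans)) pairwise_cat.
    rewrite -!(sorted_pairwise (rev_trans leq_trans)) srt andbT; apply/andP; split.
      apply/allrelP => x y; rewrite mem_nseq => /andP [_ /eqP ->] /mule.
      by move/leqW.
    by elim: (k) => [|[|j] IHj] //=; rewrite leqnn.
  - apply/allP => x; rewrite mem_cat mem_nseq => /orP [/andP [_ /eqP ->] //|].
    by move/mule/leqW.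
  - by rewrite sumn_cat sumn_nseq smu mulnC subnKC // mulnC.
case/and3P => /andP [srt n0] /allP lale /eqP sla.
pose k := count_mem m.+1 la; pose mu := [seq x <- la | x <= m].
have Ela : la = nseq k m.+1 ++ mu.
  rewrite {}/k {}/mu; elim: la srt lale {n0 sla} => [|x la IHla] //= srt lale.
  have lale' y : y \in la -> y <= m.+1 by move=> yla; rewrite lale // inE yla orbT.
  have := IHla (path_sorted srt) lale' => Ela.
  have := lale x; rewrite inE eqxx leq_eqVlt ltnS => /(_ isT)/orP [/eqP xm|xm].
    by rewrite xm eqxx ltnn /= -Ela.
  have xle y : y \in la -> y <= m.
    move: srt; rewrite (path_sortedE (rev_trans leq_trans)) => /andP [/allP h _].
    by move/h => /= yx; apply: leq_trans yx xm.
  have Ec : count_mem m.+1 la = 0.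
    apply/eqP; rewrite -leqn0 leqNgt -has_count; apply/hasPn => y /xle ym.
    by rewrite /= neq_ltn ltnS ym.
  by rewrite xm ltn_eqF ?ltnS // Ec /= {1}Ela Ec.
have kmle : k * m.+1 <= n.
  by rewrite -sla Ela sumn_cat sumn_nseq mulnC leq_addr.
apply/allpairsPdep; exists k, mu; split=> //.
  by rewrite mem_iota add0n ltnS leq_divRL.
rewrite IHm; apply/and3P; split.
- rewrite /is_part mem_filter negb_and n0 orbT andbT.
  exact: (sorted_filter (rev_trans leq_trans)).
- by apply/allP => x; rewrite mem_filter => /andP [].
- by rewrite -sla Ela sumn_cat sumn_nseq mulnC addKn.
Qed.

Lemma mem_partitions n la :
  (la \in partitions n) = is_part la && (sumn la == n).
Proof.
rewrite /partitions mem_partitions_le; congr (_ && _).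
apply/andP/idP => [[] //|/eqP <-]; split=> //.
elim: la => //= x la IHla; rewrite leq_addr /=.
by apply: sub_all IHla => y /leq_trans; apply; rewrite leq_addl.
Qed.

Lemma uniq_partitions n : uniq (partitions n).
Proof.
rewrite /partitions; move: {1}n => m; elim: m n => [|m IHm] n; first by case: n.
apply: (@allpairs_uniq_dep _ (fun=> seq nat) _
  (fun k la => nseq k m.+1 ++ la)); first exact: iota_uniq.
  by move=> k _; apply: IHm.
have count_top k la : la \in partitions_le m (n - k * m.+1) ->
    count_mem m.+1 (nseq k m.+1 ++ la) = k.
  rewrite mem_partitions_le => /and3P [_ /allP le_m _].
  rewrite count_cat count_nseq /= eqxx mul1n -[RHS]addn0; congr addn.
  apply/eqP; rewrite -leqn0 leqNgt -has_count; apply/hasPn => y /le_m ym.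
  by rewrite /= neq_ltn ltnS ym.
move=> _ _ /allpairsPdep [k [la [_ la_m ->]]] /allpairsPdep [j [mu [_ mu_m ->]]].
move=> /= E.
have Ekj : k = j by rewrite -(count_top _ _ la_m) -(count_top _ _ mu_m) E.
subst j.
by move/eqP: E; rewrite eqseq_cat // eqxx => /eqP ->.
Qed.

(* Main.v *)
From HB Require Import structures.
Require Import Defs.
From mathcomp Require Import all_boot all_order all_fingroup all_algebra.
From mathcomp Require Import zify.
From mathcomp.multinomials Require Import mpoly.

(* Let the size(al) - i shortest rows of the ribbon be the set S, and let the
   level of a row be the number of rows above it that are not in S. In a
   Littlewood-Richardson filling of the ribbon, the letters t + 1 in the rows up
   to k are at most as many as the letters t in the rows above k; going down the
   rows, this bounds the number nu_i of letters i (counted from 0) by the number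
   of boxes of S whose letter equals the level of their row. Two boxes of S in
   one column are on the same level and carry distinct letters, so each of the
   p_i columns of length two inside S contains a further box of S. Hence
   nu_i + p_i is at most the number of boxes of S.

   That c nu counts such fillings is Stembridge's argument. The functional
   f |-> sum_w sgn(w) [x^(w(nu + delta) - delta)] f, applied to a skew Schur
   function, is a signed count of tableaux. Cancel a tableau having a column
   tail {columns >= j} whose content is not a partition (j maximal) against the
   tableau obtained by a Bender-Knuth involution on the columns < j. There
   remain the tableaux of content nu all of whose column tails have partition
   content. For a Young diagram there is exactly one such tableau, filled by
   row indices, if its shape is nu, and none otherwise. *)

Set Implicit Arguments.
Unset Strict Implicit.
Unset Printing Implicit Defensive.

Import GRing.Theory.

(** * Semistandard fillings of convex diagrams *)

Section Cells.

Variable D : seq (nat * nat).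

Definition cell_row (x : seq_sub D) : nat := (val x).1.
Definition cell_col (x : seq_sub D) : nat := (val x).2.

Lemma cell_inj x y :
  cell_row x = cell_row y -> cell_col x = cell_col y -> x = y.
Proof.
rewrite /cell_row /cell_col => eq_row eq_col; apply: val_inj.
by rewrite [LHS]surjective_pairing eq_row eq_col -surjective_pairing.
Qed.

Definition convex : Prop := forall b d r c, b \in D -> d \in D ->
  b.1 <= r <= d.1 -> b.2 <= c <= d.2 -> (r, c) \in D.

Lemma convex_cell : convex -> forall x z r c,
  cell_row x <= r <= cell_row z -> cell_col x <= c <= cell_col z ->
  exists2 y, cell_row y = r & cell_col y = c.
Proof.
move=> D_convex x z r c in_rows in_cols.
have rcD := D_convex _ _ _ _ (valP x) (valP z) in_rows in_cols.
by exists (SeqSub rcD).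
Qed.

Lemma card_cells (p : pred (nat * nat)) : uniq D ->
  #|[set x : seq_sub D | p (val x)]| = count p D.
Proof.
move=> D_uniq; rewrite cardE -(size_map val) -size_filter.
apply/perm_size/uniq_perm; rewrite ?filter_uniq //.
  by rewrite map_inj_uniq ?enum_uniq //; exact: val_inj.
move=> b; rewrite mem_filter; apply/mapP/andP => [[x + ->]|[pb bD]].
  by rewrite mem_enum inE => px; rewrite px (valP x).
by exists (SeqSub bD); rewrite // mem_enum inE.
Qed.

End Cells.

Lemma semistandardP n D (T : {ffun seq_sub D -> 'I_n}) :
  reflect
    ((forall x y, cell_row x = cell_row y -> cell_col x < cell_col y ->
        T x <= T y) /\
     (forall x y, cell_col x = cell_col y -> cell_row x < cell_row y ->
        T x < T y))
    (semistandard T).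
Proof.
apply: (iffP 'forall_forallP) => [T_ssyt|[T_row T_col] x y].
  split=> x y; have /andP[/implyP T_row /implyP T_col] := T_ssyt x y.
    by move=> exy lxy; apply: T_row; apply/andP; split; first exact/eqP.
  by move=> exy lxy; apply: T_col; apply/andP; split; first exact/eqP.
apply/andP; split; apply/implyP => /andP[/eqP]; [exact: T_row | exact: T_col].
Qed.

Section SemistandardOrder.

Variables (D : seq (nat * nat)) (n : nat) (T : {ffun seq_sub D -> 'I_n}).
Hypotheses (D_convex : convex D) (T_ssyt : semistandard T).

Lemma semistandard_lt x y :
  cell_row x < cell_row y -> cell_col x <= cell_col y -> T x < T y.
Proof.
have [T_row T_col] := semistandardP _ T_ssyt; move=> lr lc.
have [||u ru cu] := convex_cell D_convex (x := x) (z := y)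
    (r := cell_row x) (c := cell_col y); [by lia | by lia |].
have lt_uy : T u < T y by apply: T_col; rewrite ?cu ?ru.
move: lc; rewrite leq_eqVlt => /orP[/eqP exy|lt_xy].
  by rewrite (@cell_inj _ x u) ?cu.
by apply: leq_ltn_trans lt_uy; apply: T_row; rewrite ?ru ?cu.
Qed.

Lemma semistandard_le x y :
  cell_row x <= cell_row y -> cell_col x <= cell_col y -> T x <= T y.
Proof.
rewrite leq_eqVlt => /orP[/eqP exy|lr lc]; last exact/ltnW/semistandard_lt.
rewrite leq_eqVlt => /orP[/eqP cxy|]; first by rewrite (cell_inj exy cxy).
by have [T_row _] := semistandardP _ T_ssyt; apply: T_row.
Qed.

Lemma semistandard_col_inj x y : cell_col x = cell_col y -> T x = T y -> x = y.
Proof.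
move=> cxy Txy; apply: cell_inj => //.
have [lt_xy|lt_yx|//] := ltngtP (cell_row x) (cell_row y).
  by have := semistandard_lt lt_xy (eq_leq cxy); rewrite Txy ltnn.
by have := semistandard_lt lt_yx (eq_leq (esym cxy)); rewrite Txy ltnn.
Qed.

End SemistandardOrder.

Section Content.

Variables (D : seq (nat * nat)) (n : nat).
Implicit Types (T : {ffun seq_sub D -> 'I_n}) (p q : pred (seq_sub D)).

Definition content_in p T (a : nat) : nat := #|[set x | p x & T x == a :> nat]|.

Definition content : {ffun seq_sub D -> 'I_n} -> nat -> nat := content_in predT.

Definition content_from (j : nat) : {ffun seq_sub D -> 'I_n} -> nat -> nat :=
  content_in (fun x => j <= cell_col x).

Lemma eq_content_in p q T a : p =1 q -> content_in p T a = content_in q T a.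
Proof. by move=> epq; apply: eq_card => x; rewrite !inE epq. Qed.

Lemma leq_content_in p q T a b :
  (forall x, p x -> T x = a :> nat -> q x && (T x == b :> nat)) ->
  content_in p T a <= content_in q T b.
Proof.
move=> pq; apply/subset_leq_card/subsetP => x; rewrite !inE.
by case/andP=> px /eqP/(pq x px).
Qed.

Lemma content_in0 p T a :
  (forall x, p x -> T x != a :> nat) -> content_in p T a = 0.
Proof.
move=> none; apply: eq_card0 => x; rewrite !inE.
by apply/negP => /andP[/none/negbTE->].
Qed.

Lemma content_inID q p T a :
  content_in p T a = content_in (predI p q) T a + content_in (predD p q) T a.
Proof.
rewrite /content_in -(cardsID [set x | q x]).
by congr (_ + _); apply: eq_card => x; rewrite !inE /=; case: (q x); lia.
Qed.

Lemma contentID j T a :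
  content T a = content_from j T a + content_in (fun x => cell_col x < j) T a.
Proof.
rewrite /content (content_inID (fun x => j <= cell_col x)).
by congr (_ + _); apply: eq_content_in => x; rewrite /= ?andbT -?ltnNge.
Qed.

Lemma content_from_rec j T a : content_from j T a =
  content_from j.+1 T a + content_in (fun x => cell_col x == j) T a.
Proof.
rewrite /content_from (content_inID (fun x => j < cell_col x)).
by congr (_ + _); apply: eq_content_in => x /=; lia.
Qed.

Lemma content_column_le1 j T a : convex D -> semistandard T ->
  content_in (fun x => cell_col x == j) T a <= 1.
Proof.
move=> D_convex T_ssyt; apply/card_le1_eqP => x y; rewrite !inE.
move=> /andP[/eqP cx /eqP Tx] /andP[/eqP cy /eqP Ty].
apply: (semistandard_col_inj D_convex T_ssyt); first by rewrite cx.
by apply: val_inj; rewrite /= Tx.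
Qed.

End Content.

(** * Bender-Knuth involutions on column prefixes *)

Section OrderReversal.

Variables (X : finType) (f : X -> nat) (A : {set X}).

Local Notation s := (sort (relpre f leq) (enum A)).

Definition order_reversal (x : X) : X := nth x (rev s) (index x s).

Let mem_s x : (x \in s) = (x \in A).
Proof. by rewrite mem_sort mem_enum. Qed.

Let index_lt x : x \in A -> index x s < size s.
Proof. by rewrite index_mem mem_s. Qed.

Lemma order_reversal_in x : x \in A -> order_reversal x \in A.
Proof.
by move=> /index_lt lt_x; rewrite -mem_s -mem_rev mem_nth // size_rev.
Qed.

Let index_reversal x : x \in A ->
  index (order_reversal x) s = size s - (index x s).+1.
Proof.
move=> /index_lt lt_x; rewrite /order_reversal nth_rev // index_uniq //.
  by rewrite ltn_subrL (leq_trans _ lt_x).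
by rewrite sort_uniq enum_uniq.
Qed.

Lemma order_reversalK : {in A, involutive order_reversal}.
Proof.
move=> x xA; have lt_x := index_lt xA.
rewrite {1}/order_reversal index_reversal // nth_rev; last by lia.
by rewrite (_ : _ - _ = index x s) ?nth_index ?mem_s //; lia.
Qed.

Lemma order_reversal_anti : {in A &, injective f} ->
  {in A &, forall x y,
    f x < f y -> f (order_reversal y) < f (order_reversal x)}.
Proof.
move=> f_inj x y xA yA lt_f.
have f_mono : {in A &, forall u v, index u s < index v s -> f u <= f v}.
  move=> u v uA vA; apply: (sorted_ltn_index (leT := relpre f leq)).
  - by move=> ? ? ?; exact: leq_trans.
  - by apply: sort_sorted => ? ?; exact: leq_total.
  - by rewrite mem_s.
  - by rewrite mem_s.
have lt_index : index x s < index y s.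
  rewrite ltn_neqAle leqNgt; apply/andP; split.
    by apply: contraL lt_f => /eqP/index_inj->; rewrite ?ltnn ?mem_s.
  by apply: contraL lt_f => /(f_mono _ _ yA xA); rewrite leqNgt.
have [rxA ryA] := (order_reversal_in xA, order_reversal_in yA).
have lt_reversal : index (order_reversal y) s < index (order_reversal x) s.
  by rewrite !index_reversal //; have := index_lt yA; lia.
rewrite ltn_neqAle f_mono // andbT; apply/eqP => /(f_inj _ _ ryA rxA) eq_yx.
by rewrite eq_yx ltnn in lt_reversal.
Qed.

End OrderReversal.

Section Matching.

Variables (D : seq (nat * nat)) (P : {set seq_sub D}).

Definition partner (x : seq_sub D) : option (seq_sub D) :=
  [pick y in P | (y != x) && (cell_col y == cell_col x)].

Definition free_cells : {set seq_sub D} := [set x in P | partner x == None].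

Definition free_row (r : nat) : {set seq_sub D} :=
  [set x in free_cells | cell_row x == r].

Definition match_cell (x : seq_sub D) : seq_sub D :=
  if x \in P then
    odflt (order_reversal (@cell_col D) (free_row (cell_row x)) x) (partner x)
  else x.

Lemma free_cellsW x : x \in free_cells -> x \in P.
Proof. by rewrite inE => /andP[]. Qed.

Lemma free_cells_col x y :
  x \in free_cells -> y \in P -> cell_col y = cell_col x -> y = x.
Proof.
rewrite inE /partner; case: pickP => [? _|none]; rewrite ?andbF // => _ yP cyx.
by apply/eqP; have := none y; rewrite yP cyx eqxx andbT => /negbFE.
Qed.

Lemma partnerP x : x \in P -> x \notin free_cells ->
  exists y, [/\ partner x = Some y, y \in P, y != x & cell_col y = cell_col x].
Proof.
rewrite inE => ->; rewrite /partner.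
by case: pickP => // y /and3P[yP yx /eqP cyx] _; exists y.
Qed.

Lemma match_cell_free x : x \in free_cells ->
  match_cell x = order_reversal (@cell_col D) (free_row (cell_row x)) x.
Proof. by rewrite inE /match_cell => /andP[-> /eqP->]. Qed.

Lemma mem_free_row x : x \in free_cells -> x \in free_row (cell_row x).
Proof. by rewrite [x \in free_row _]inE eqxx andbT. Qed.

Lemma match_cell_free_row x : x \in free_cells ->
  match_cell x \in free_row (cell_row x).
Proof.
by move=> xF; rewrite match_cell_free //; apply/order_reversal_in/mem_free_row.
Qed.

Lemma match_cell_free_anti : {in free_cells &, forall x y,
  cell_row x = cell_row y -> cell_col x < cell_col y ->
  cell_col (match_cell y) < cell_col (match_cell x)}.
Proof.
move=> x y xF yF rxy; rewrite !match_cell_free // -rxy.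
apply: order_reversal_anti; rewrite ?mem_free_row //; last first.
  by rewrite rxy mem_free_row.
move=> u v /[!inE] /andP[_ /eqP ru] /andP[_ /eqP rv].
by apply: cell_inj; rewrite ru.
Qed.

Lemma match_cell_in x : (match_cell x \in P) = (x \in P).
Proof.
have [xP|xP] := boolP (x \in P); last first.
  by rewrite /match_cell (negbTE xP) (negbTE xP).
have [xF|xF] := boolP (x \in free_cells).
  have := match_cell_free_row xF; rewrite inE => /andP[mF _].
  exact: free_cellsW.
by have [y [py yP _ _]] := partnerP xP xF; rewrite /match_cell xP py.
Qed.

Hypothesis P_columns : forall x y z, x \in P -> y \in P -> z \in P ->
  cell_col y = cell_col x -> cell_col z = cell_col x ->
  y != x -> z != x -> y = z.

Lemma match_cellK : involutive match_cell.
Proof.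
move=> x; have [xP|xP] := boolP (x \in P); last first.
  by rewrite /match_cell !(negbTE xP).
have [xF|xF] := boolP (x \in free_cells).
  have := match_cell_free_row xF; rewrite inE => /andP[mF /eqP rm].
  rewrite match_cell_free // rm match_cell_free //.
  by rewrite order_reversalK ?mem_free_row.
have [y [py yP nyx cyx]] := partnerP xP xF.
have yF : y \notin free_cells.
  by apply: contra nyx => yF; rewrite (free_cells_col yF xP) ?cyx.
have [z [pz zP nzy czy]] := partnerP yP yF.
rewrite {2}/match_cell xP py /= /match_cell yP pz /=.
by apply: (P_columns yP); rewrite // eq_sym.
Qed.

End Matching.

Section BenderKnuth.

Variables (D : seq (nat * nat)) (n j : nat) (k k' : 'I_n).
Hypotheses (D_convex : convex D) (kS : k' = k.+1 :> nat).
Implicit Type T : {ffun seq_sub D -> 'I_n}.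

Definition letters_before T : {set seq_sub D} :=
  [set x | (cell_col x < j) && (k <= T x <= k')].

(* Matched letters trade places twice, hence stay put, while the string of free
   letters of each row is reversed and has its two letters exchanged. *)
Definition bender_knuth T : {ffun seq_sub D -> 'I_n} :=
  [ffun x => if x \in letters_before T
             then tperm k k' (T (match_cell (letters_before T) x)) else T x].

Lemma tperm_adjacent (a : 'I_n) :
  k <= a <= k' -> tperm k k' a = k + k' - a :> nat.
Proof.
case: tpermP => [->|->|]; [by lia | by lia |].
by move=> /eqP + /eqP; rewrite -!val_eqE /=; lia.
Qed.

Lemma tperm_outside (a : 'I_n) : ~~ (k <= a <= k') -> tperm k k' a = a.
Proof. by case: tpermP => // ->; lia. Qed.

Lemma bender_knuth_ge T x : j <= cell_col x -> bender_knuth T x = T x.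
Proof. by move=> jx; rewrite ffunE inE ltnNge jx. Qed.

Lemma content_from_bender_knuth i T : j <= i ->
  content_from i (bender_knuth T) =1 content_from i T.
Proof.
move=> ji a; apply: eq_card => x; rewrite !inE.
by have [/(leq_trans ji)/bender_knuth_ge-> //|] := leqP i (cell_col x).
Qed.

Section OneFilling.

Variable T : {ffun seq_sub D -> 'I_n}.
Hypothesis T_ssyt : semistandard T.

Local Notation P := (letters_before T).
Local Notation free := (free_cells P).

Lemma letters_beforeP x :
  reflect (cell_col x < j /\ k <= T x <= k') (x \in P).
Proof. by rewrite inE; exact: andP. Qed.

Lemma letters_before_col x y : x \in P -> y \in P ->
  cell_col y = cell_col x -> y != x -> T x + T y = k + k'.
Proof.
move=> /letters_beforeP[_ Tx] /letters_beforeP[_ Ty] cyx nyx.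
have : T y != T x :> nat; last by lia.
apply: contra nyx => /eqP/val_inj Tyx.
exact/eqP/(semistandard_col_inj D_convex T_ssyt).
Qed.

Lemma letters_before_pair x y z : x \in P -> y \in P -> z \in P ->
  cell_col y = cell_col x -> cell_col z = cell_col x ->
  y != x -> z != x -> y = z.
Proof.
move=> xP yP zP cyx czx /(letters_before_col xP yP cyx) Tyx.
move=> /(letters_before_col xP zP czx) Tzx.
apply: (semistandard_col_inj D_convex T_ssyt); first by rewrite cyx.
by apply: val_inj => /=; lia.
Qed.

Lemma match_letters_beforeK : involutive (match_cell P).
Proof. exact/match_cellK/letters_before_pair. Qed.

Lemma match_cell_before x : (cell_col (match_cell P x) < j) = (cell_col x < j).
Proof.
have [xP|xP] := boolP (x \in P); last by rewrite /match_cell (negbTE xP).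
have mP : match_cell P x \in P by rewrite match_cell_in.
by have [-> _] := letters_beforeP _ xP; have [-> _] := letters_beforeP _ mP.
Qed.

Lemma bender_knuth_before x : cell_col x < j ->
  bender_knuth T x = tperm k k' (T (match_cell P x)).
Proof.
move=> xj; rewrite ffunE; case: ifPn => // xP.
rewrite /match_cell (negbTE xP) tperm_outside //.
by move: xP; rewrite inE xj.
Qed.

Lemma bender_knuth_fixed x : x \notin free -> bender_knuth T x = T x.
Proof.
move=> xF; rewrite ffunE; case: ifP => // xP.
have [y [py yP nyx cyx]] := partnerP xP xF.
have Tyx := letters_before_col xP yP cyx nyx.
have [_ Ty] := letters_beforeP _ yP; apply: val_inj.
by rewrite /match_cell xP py /= tperm_adjacent //; lia.
Qed.

Lemma bender_knuth_letter x : x \in P -> k <= bender_knuth T x <= k'.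
Proof.
move=> xP; have [xj _] := letters_beforeP _ xP.
have mP : match_cell P x \in P by rewrite match_cell_in.
have [_ Tm] := letters_beforeP _ mP.
by rewrite bender_knuth_before // tperm_adjacent //; lia.
Qed.

Lemma letters_before_bender_knuth : letters_before (bender_knuth T) = P.
Proof.
apply/setP => x; have [xP|xP] := boolP (x \in P).
  by rewrite inE bender_knuth_letter //; case: (letters_beforeP _ xP) => ->.
by rewrite inE ffunE (negbTE xP); move: xP; rewrite inE => /negbTE.
Qed.

Lemma bender_knuthK : bender_knuth (bender_knuth T) = T.
Proof.
apply/ffunP => x; rewrite [LHS]ffunE letters_before_bender_knuth.
case: ifP => xP; last by rewrite ffunE xP.
have [xj _] := letters_beforeP _ xP.
rewrite bender_knuth_before ?match_cell_before //.
by rewrite match_letters_beforeK tpermK.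
Qed.

Lemma content_bender_knuth (a : 'I_n) : content (bender_knuth T) a =
  content_from j T a + content_in (fun x => cell_col x < j) T (tperm k k' a).
Proof.
rewrite (contentID j) content_from_bender_knuth //; congr (_ + _).
rewrite /content_in -(card_imset _ (can_inj match_letters_beforeK)).
apply: eq_card => x; apply/imsetP/idP => [[y + ->]|].
  rewrite !inE match_cell_before => /andP[yj /eqP/val_inj <-].
  by rewrite yj bender_knuth_before // tpermK eqxx.
rewrite inE => /andP[xj /eqP/val_inj Tx].
exists (match_cell P x); last by rewrite match_letters_beforeK.
rewrite inE match_cell_before xj bender_knuth_before ?match_cell_before //.
by rewrite match_letters_beforeK Tx tpermK eqxx.
Qed.

(* Otherwise the cell in the row of y and the column of x would hold k' and be
   the partner of x. *)
Lemma free_cell_southeast x y : x \in free ->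
  cell_row x < cell_row y -> cell_col x <= cell_col y -> k' < T y.
Proof.
move=> xF lr lc; rewrite ltnNge; apply/negP => Ty.
have [xj /andP[Tx _]] := letters_beforeP _ (free_cellsW xF).
have [||t rt ct] := convex_cell D_convex (x := x) (z := y)
    (r := cell_row y) (c := cell_col x); rewrite ?leqnn ?lc ?(ltnW lr) //.
have Txt : T x < T t by apply: semistandard_lt; rewrite // ?rt ?ct.
have Tty : T t <= T y by apply: semistandard_le; rewrite // ?rt ?ct.
have tP : t \in P.
  apply/letters_beforeP; rewrite ct (leq_trans Tty Ty) andbT; split=> //.
  exact: leq_trans (ltnW Txt).
by rewrite (free_cells_col xF tP ct) ltnn in Txt.
Qed.

Lemma free_cell_northwest x y : y \in free ->
  cell_row x < cell_row y -> cell_col x <= cell_col y -> T x < k.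
Proof.
move=> yF lr lc; rewrite ltnNge; apply/negP => Tx.
have [yj /andP[_ Ty]] := letters_beforeP _ (free_cellsW yF).
have [||t rt ct] := convex_cell D_convex (x := x) (z := y)
    (r := cell_row x) (c := cell_col y); rewrite ?leqnn ?lc ?(ltnW lr) //.
have Txt : T x <= T t by apply: semistandard_le; rewrite // ?rt ?ct.
have Tty : T t < T y by apply: semistandard_lt; rewrite // ?rt ?ct.
have tP : t \in P.
  apply/letters_beforeP; rewrite ct (leq_trans Tx Txt); split=> //.
  exact: leq_trans (ltnW Tty) Ty.
by rewrite (free_cells_col yF tP ct) ltnn in Tty.
Qed.

Hypothesis no_k : forall x, cell_col x = j -> T x != k.

Lemma free_cell_right x y : x \in free -> y \notin free ->
  cell_row x = cell_row y -> cell_col x < cell_col y -> k' <= T y.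
Proof.
move=> xF yF rxy cxy; rewrite kS ltnNge; apply/negP => Ty.
have [xj /andP[Tx _]] := letters_beforeP _ (free_cellsW xF).
have Txy := semistandard_le D_convex T_ssyt (eq_leq rxy) (ltnW cxy).
have [yj|jy] := ltnP (cell_col y) j.
  have yP : y \in P by apply/letters_beforeP; split=> //; lia.
  have [z [_ zP nzy czy]] := partnerP yP yF.
  have Tyz := letters_before_col yP zP czy nzy.
  have ryz : cell_row y < cell_row z.
    rewrite ltnNge; apply/negP => rzy.
    by have := semistandard_le D_convex T_ssyt rzy (eq_leq czy); lia.
  have := free_cell_southeast xF (y := z); rewrite rxy czy.
  by move=> /(_ ryz (ltnW cxy)); lia.
have [||z rz cz] := convex_cell D_convex (x := x) (z := y)
    (r := cell_row x) (c := j); [by lia | by lia |].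
have Txz : T x <= T z by apply: semistandard_le; rewrite // ?rz ?cz // ltnW.
have Tzy : T z <= T y by apply: semistandard_le; rewrite // ?rz ?cz ?rxy.
case/eqP: (no_k cz); apply/val_inj/eqP.
by rewrite eqn_leq /= (leq_trans Tzy) ?(leq_trans Tx).
Qed.

Lemma free_cell_left x y : x \notin free -> y \in free ->
  cell_row x = cell_row y -> cell_col x < cell_col y -> T x <= k.
Proof.
move=> xF yF rxy cxy; rewrite leqNgt; apply/negP => Tx.
have [yj /andP[_ Ty]] := letters_beforeP _ (free_cellsW yF).
have Txy := semistandard_le D_convex T_ssyt (eq_leq rxy) (ltnW cxy).
have xP : x \in P.
  apply/letters_beforeP.
  by rewrite (ltn_trans cxy yj) (ltnW Tx) (leq_trans Txy).
have [z [_ zP nzx czx]] := partnerP xP xF.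
have Txz := letters_before_col xP zP czx nzx.
have rzx : cell_row z < cell_row x.
  rewrite ltnNge; apply/negP => rxz.
  by have := semistandard_le D_convex T_ssyt rxz (eq_leq (esym czx)); lia.
have := free_cell_northwest yF (x := z); rewrite -rxy czx.
by move=> /(_ rzx (ltnW cxy)); lia.
Qed.

Lemma bender_knuth_free_row x y : x \in free -> y \in free ->
  cell_row x = cell_row y -> cell_col x < cell_col y ->
  bender_knuth T x <= bender_knuth T y.
Proof.
move=> xF yF rxy cxy.
have [xP yP] := (free_cellsW xF, free_cellsW yF).
have [mxP myP] : match_cell P x \in P /\ match_cell P y \in P.
  by rewrite !match_cell_in.
have [[_ Tmx] [_ Tmy]] := (letters_beforeP _ mxP, letters_beforeP _ myP).
have rm z : z \in free -> cell_row (match_cell P z) = cell_row z.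
  by move/match_cell_free_row; rewrite inE => /andP[_ /eqP].
have leT : T (match_cell P y) <= T (match_cell P x).
  apply: semistandard_le; rewrite ?rm ?rxy //.
  exact/ltnW/match_cell_free_anti.
by rewrite !ffunE xP yP !tperm_adjacent //; lia.
Qed.

Lemma bender_knuth_semistandard : semistandard (bender_knuth T).
Proof.
have letter_ge x : x \in free -> k <= bender_knuth T x.
  by move/free_cellsW/bender_knuth_letter/andP=> [].
have letter_le x : x \in free -> bender_knuth T x <= k'.
  by move/free_cellsW/bender_knuth_letter/andP=> [].
have [T_row T_col] := semistandardP _ T_ssyt.
apply/semistandardP; split=> x y exy lxy;
  have [xF|xF] := boolP (x \in free); have [yF|yF] := boolP (y \in free);
  rewrite ?(bender_knuth_fixed xF) ?(bender_knuth_fixed yF).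
- exact: bender_knuth_free_row.
- exact: leq_trans (letter_le x xF) (free_cell_right xF yF exy lxy).
- exact: leq_trans (free_cell_left xF yF exy lxy) (letter_ge y yF).
- exact: T_row.
- by rewrite (free_cells_col yF (free_cellsW xF) exy) ltnn in lxy.
- apply: leq_ltn_trans (letter_le x xF) _.
  exact: free_cell_southeast xF lxy (eq_leq exy).
- apply: leq_trans (letter_ge y yF).
  exact: free_cell_northwest yF lxy (eq_leq exy).
- exact: T_col.
Qed.

End OneFilling.

End BenderKnuth.

(** * Coefficients of antisymmetrized monomials *)

Lemma perm_ord_homo_ltn n (w : 'S_n) :
  (forall a b : 'I_n, a < b -> w a < w b) -> w = 1%g.
Proof.
move=> w_homo; pose lt_ord (a b : 'I_n) := a < b.
have enum_sorted : sorted lt_ord (enum 'I_n).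
  by have := iota_ltn_sorted 0 n; rewrite -val_enum_ord sorted_map.
have w_enum : map w (enum 'I_n) = map id (enum 'I_n).
  rewrite map_id; apply: (irr_sorted_eq (leT := lt_ord)) => //.
  - by move=> b a c; exact: ltn_trans.
  - by move=> a; exact: ltnn.
  - by rewrite sorted_map; apply: sub_sorted enum_sorted.
  move=> a; rewrite mem_enum; apply/mapP; exists (w^-1 a)%g.
    by rewrite mem_enum.
  by rewrite permKV.
move/eq_in_map: w_enum => w_id; apply/permP => a.
by rewrite perm1 w_id ?mem_enum.
Qed.

Section AlternatingCoef.

Variable n : nat.
Implicit Types m M : 'X_{1..n}.

Local Notation "m # w" := [multinom m (w i) | i < n]
  (at level 40, left associativity).

Definition staircase : 'X_{1..n} := [multinom n - i.+1 | i < n].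

Definition dominant m : Prop := forall a b : 'I_n, a <= b -> m b <= m a.

Definition alternating_coef m M : int :=
  (\sum_(w : 'S_n) (-1) ^+ w * (m == M # w)%:R)%R.

Lemma alternating_coef_perm (s : 'S_n) m M :
  (alternating_coef (m # s) M = (-1) ^+ s * alternating_coef m M)%R.
Proof.
rewrite /alternating_coef (reindex_inj (mulgI s)) mulr_sumr.
apply: eq_bigr => w _; rewrite odd_permM signr_addb mulrA.
congr (_ * _%:R)%R; congr nat_of_bool.
apply/eqP/eqP => [/mnmP e|->]; apply/mnmP => i; rewrite !mnmE ?permM //.
by have := e (s^-1 i)%g; rewrite !mnmE permM permKV.
Qed.

Lemma alternating_coef_dominant m M : dominant m -> dominant M ->
  alternating_coef (m + staircase)%MM (M + staircase)%MM = (m == M)%:R%R.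
Proof.
move=> m_dom M_dom; rewrite /alternating_coef (bigD1 1%g) //= big1 => [|w].
  rewrite odd_perm1 expr0 mul1r addr0 (_ : _ # _ = M + staircase)%MM.
    by rewrite eqm_add2r.
  by apply/mnmP => a; rewrite mnmE perm1.
move=> /eqP w_neq1; case: eqP => [/mnmP e|_]; rewrite ?mulr0 //.
case: w_neq1; apply: perm_ord_homo_ltn => a b lt_ab.
rewrite ltnNge; apply/negP => le_wba.
have := m_dom a b (ltnW lt_ab); have := M_dom _ _ le_wba.
have := e a; have := e b; rewrite !mnmE.
by have := ltn_ord b; have := ltn_ord (w a); lia.
Qed.

(* For symmetric p this is the coefficient of 'X_[M + staircase] in the
   product of p with the Vandermonde alternant. *)
Definition schur_coef M (p : {mpoly int[n]}) : int :=
  (\sum_(w : 'S_n)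
     (-1) ^+ w * (p * 'X_[staircase])@_((M + staircase)%MM # w))%R.

Lemma schur_coef_is_scalar M : scalar (schur_coef M).
Proof.
move=> c p q; rewrite /schur_coef mulr_sumr -big_split /=.
apply: eq_bigr => w _.
by rewrite mulrDl mcoeffD mulrDr -scalerAl mcoeffZ mulrCA.
Qed.

HB.instance Definition _ M :=
  GRing.isLinear.Build int {mpoly int[n]} int _ (schur_coef M)
    (schur_coef_is_scalar M).

Lemma schur_coef_mpolyX M m :
  schur_coef M 'X_[m] =
  alternating_coef (m + staircase)%MM (M + staircase)%MM.
Proof.
by apply: eq_bigr => w _; rewrite -mpolyXD mcoeffX.
Qed.

End AlternatingCoef.

(** * The sign-reversing involution *)

Section Lattice.

Variables (D : seq (nat * nat)) (n : nat).
Implicit Type T : {ffun seq_sub D -> 'I_n}.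

Definition lattice_from (j : nat) T : bool :=
  [forall a : 'I_n, content_from j T a.+1 <= content_from j T a].

Definition lattice_beyond (j : nat) T : bool :=
  [forall x : seq_sub D, (j <= cell_col x) ==> lattice_from (cell_col x) T].

Definition lattice T : bool := lattice_beyond 0 T.

Lemma lattice_fromP j T :
  reflect (forall a, content_from j T a.+1 <= content_from j T a)
    (lattice_from j T).
Proof.
apply: (iffP forallP) => [T_lat a|T_lat a]; last exact: T_lat.
have [an|na] := ltnP a n; first exact: T_lat (Ordinal an).
rewrite /content_from content_in0 // => x _.
by rewrite neq_ltn (leq_trans (ltn_ord _)) // ltnW.
Qed.

Lemma lattice_beyondP j T :
  reflect (forall i, j <= i -> lattice_from i T) (lattice_beyond j T).
Proof.
apply: (iffP forallP) => [T_lat i ji|T_lat x]; last exact/implyP/T_lat.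
have [x ix|none] := pickP (fun x : seq_sub D => i <= cell_col x); last first.
  apply/lattice_fromP => a; rewrite /content_from content_in0 // => x.
  by rewrite none.
have [y iy y_min] :=
  @arg_minnP _ x (fun z => i <= cell_col z) (@cell_col D) ix.
have same_tail : content_from (cell_col y) T =1 content_from i T.
  move=> a; apply: eq_content_in => z.
  by apply/idP/idP => [|/y_min //]; exact: leq_trans.
apply/lattice_fromP => a; rewrite -!same_tail; apply/lattice_fromP.
by apply: (implyP (T_lat y)); exact: leq_trans iy.
Qed.

Lemma latticeP T : reflect (forall j, lattice_from j T) (lattice T).
Proof.
by apply: (iffP (lattice_beyondP 0 T)) => T_lat j *; exact: T_lat.
Qed.

Lemma lattice_beyond_rec j T :
  lattice_beyond j T = lattice_beyond j.+1 T && lattice_from j T.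
Proof.
apply/lattice_beyondP/andP => [T_lat|[/lattice_beyondP T_lat T_j] i].
  by split; [apply/lattice_beyondP => i /ltnW/T_lat | exact: T_lat].
by rewrite leq_eqVlt => /orP[/eqP <-|/T_lat].
Qed.

Definition weight T : 'X_{1..n} := [multinom content T a | a < n].

Lemma lattice_dominant T : lattice T -> dominant (weight T).
Proof.
move=> /latticeP/(_ 0)/lattice_fromP T_lat a b ab; rewrite !mnmE.
have content0 c : content T c = content_from 0 T c by exact: eq_content_in.
rewrite !content0; move: ab; elim: (b : nat) => [|c IHc].
  by rewrite leqn0 => /eqP->.
rewrite leq_eqVlt ltnS => /orP[/eqP-> //|/IHc].
exact: leq_trans.
Qed.

End Lattice.

Section Cancellation.

Variables (D : seq (nat * nat)) (n : nat) (M : 'X_{1..n}).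
Hypothesis D_convex : convex D.
Implicit Type T : {ffun seq_sub D -> 'I_n}.

Definition signed_count T : int :=
  alternating_coef (weight T + staircase n)%MM (M + staircase n)%MM.

Definition violation j T : option ('I_n * 'I_n) :=
  [pick p : 'I_n * 'I_n | (p.2 == p.1.+1 :> nat)
     && (content_from j T p.1 < content_from j T p.2)].

Definition reflect_at j T : {ffun seq_sub D -> 'I_n} :=
  if violation j T is Some (a, b) then bender_knuth j a b T else T.

Lemma lattice_fromPn j T : ~~ lattice_from j T ->
  exists a b, violation j T = Some (a, b).
Proof.
case/forallPn=> a; rewrite -ltnNge => lt_a.
have an : a.+1 < n.
  rewrite ltnNge; apply: contraL lt_a => na; rewrite -leqNgt.
  rewrite /content_from content_in0 // => x _.
  by rewrite neq_ltn (leq_trans (ltn_ord _)).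
rewrite /violation; case: pickP => [[b c] _|/(_ (a, Ordinal an))].
  by exists b, c.
by rewrite /= eqxx lt_a.
Qed.

(* Column j adds at most one letter of each kind to a tail of partition
   content, so the first failure is by exactly one. *)
Lemma violation_column j T a b : semistandard T -> lattice_from j.+1 T ->
  violation j T = Some (a, b) ->
  [/\ b = a.+1 :> nat, content_from j T b = (content_from j T a).+1
    & forall x, cell_col x = j -> T x != a].
Proof.
move=> T_ssyt /lattice_fromP/(_ a) T_lat; rewrite /violation.
case: pickP => // p /andP[/eqP ba lt_ab] [ep]; rewrite {p}ep /= in ba lt_ab.
have := content_column_le1 j b D_convex T_ssyt; move: lt_ab T_lat.
rewrite (content_from_rec j T a) (content_from_rec j T b) ba => lt_ab T_lat le1.
split=> // [|x cx]; first by lia.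
have : content_in (fun x => cell_col x == j) T a = 0 by lia.
move/eqP; rewrite cards_eq0 => /eqP/setP/(_ x); rewrite !inE cx eqxx.
by move=> /negbT.
Qed.

Section OneFilling.

Variables (j : nat) (T : {ffun seq_sub D -> 'I_n}).
Hypotheses (T_ssyt : semistandard T) (T_lat : lattice_from j.+1 T).

Lemma reflect_at_semistandard : semistandard (reflect_at j T).
Proof.
rewrite /reflect_at; case ev: (violation j T) => [[a b]|] //.
have [ba _ no_a] := violation_column T_ssyt T_lat ev.
exact: bender_knuth_semistandard.
Qed.

Lemma content_from_reflect_at i :
  j <= i -> content_from i (reflect_at j T) =1 content_from i T.
Proof.
move=> ji; rewrite /reflect_at; case: (violation j T) => [[a b]|] //.
exact: content_from_bender_knuth.
Qed.

Lemma lattice_from_reflect_at i :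
  j <= i -> lattice_from i (reflect_at j T) = lattice_from i T.
Proof.
by move=> ji; apply: eq_forallb => a; rewrite !content_from_reflect_at.
Qed.

Lemma reflect_atK : reflect_at j (reflect_at j T) = T.
Proof.
rewrite {1}/reflect_at (_ : violation j _ = violation j T); last first.
  by apply: eq_pick => p; rewrite !content_from_reflect_at.
rewrite /reflect_at; case ev: (violation j T) => [[a b]|] //.
have [ba _ _] := violation_column T_ssyt T_lat ev.
exact: bender_knuthK.
Qed.

Lemma signed_count_reflect_at : ~~ lattice_from j T ->
  signed_count (reflect_at j T) = (- signed_count T)%R.
Proof.
move=> /lattice_fromPn[a [b ev]].
have [ba cb _] := violation_column T_ssyt T_lat ev.
rewrite /signed_count.
have -> : (weight (reflect_at j T) + staircase n)%MM =
    [multinom (weight T + staircase n)%MM (tperm a b i) | i < n].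
  apply/mnmP => c; rewrite /reflect_at ev !mnmE content_bender_knuth //.
  rewrite (contentID j T); case: tpermP => [->|->|_ _] //; rewrite cb ba.
    by have := ltn_ord b; lia.
  by have := ltn_ord b; lia.
rewrite alternating_coef_perm odd_tperm (_ : a != b) ?expr1 ?mulN1r //.
by rewrite -val_eqE /= ba; lia.
Qed.

End OneFilling.

Definition violating j T : bool :=
  [&& semistandard T, lattice_beyond j.+1 T & ~~ lattice_from j T].

Lemma violatingP j T : violating j T ->
  [/\ semistandard T, lattice_from j.+1 T & ~~ lattice_from j T].
Proof. by case/and3P=> T_ssyt /lattice_beyondP/(_ j.+1)->. Qed.

Lemma reflect_at_violating j T : violating j T -> violating j (reflect_at j T).
Proof.
move=> T_violating; have [T_ssyt T_lat nT] := violatingP T_violating.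
case/and3P: T_violating => _ /lattice_beyondP T_beyond _; apply/and3P; split.
- exact: reflect_at_semistandard.
- apply/lattice_beyondP => i ji.
  by rewrite lattice_from_reflect_at ?T_beyond // ltnW.
- by rewrite lattice_from_reflect_at.
Qed.

Lemma sum_signed_count_violating j :
  (\sum_(T | violating j T) signed_count T = 0)%R.
Proof.
have reflectK T : violating j T -> reflect_at j (reflect_at j T) = T.
  by case/violatingP => T_ssyt T_lat _; exact: reflect_atK.
set S := (\sum_(T | _) _)%R; suff : (S = - S)%R by lia.
rewrite {1}/S (reindex_onto (reflect_at j) (reflect_at j)) //= -sumrN.
apply: eq_big => [T|T /andP[/reflect_at_violating + /eqP KT]].
  apply/andP/idP => [[/reflect_at_violating + /eqP KT]|T_violating].
    by rewrite KT.
  by rewrite reflectK ?reflect_at_violating.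
by rewrite KT => /violatingP[T_ssyt T_lat nT]; exact: signed_count_reflect_at.
Qed.

Lemma sum_signed_count_beyond j :
  (\sum_(T | semistandard T && lattice_beyond j T) signed_count T =
   \sum_(T | semistandard T && lattice T) signed_count T)%R.
Proof.
elim: j => [//|j <-]; rewrite (bigID (lattice_from j)) /=.
under [X in (_ + X)%R]eq_bigl do rewrite -andbA.
rewrite sum_signed_count_violating addr0.
by apply: eq_bigl => T; rewrite -andbA -lattice_beyond_rec.
Qed.

Definition lr_filling T : bool :=
  [&& semistandard T, lattice T & weight T == M].

Hypothesis M_dominant : dominant M.

Lemma sum_signed_count :
  (\sum_(T | semistandard T) signed_count T =
   #|[set T | lr_filling T]|%:R)%R.
Proof.
pose J := (\max_(x : seq_sub D) cell_col x).+1.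
have beyond_J T : lattice_beyond J T.
  by apply/forallP => x; rewrite leqNgt ltnS (leq_bigmax x).
have -> : (\sum_(T | semistandard T) signed_count T =
    \sum_(T | semistandard T && lattice_beyond J T) signed_count T)%R.
  by apply: eq_bigl => T; rewrite beyond_J andbT.
rewrite sum_signed_count_beyond -sum1dep_card natr_sum.
under [RHS]eq_bigl do rewrite /lr_filling andbA.
rewrite [RHS]big_mkcondr; apply: eq_bigr => T /andP[_ T_lat].
rewrite /signed_count alternating_coef_dominant //; first by case: eqP.
exact: lattice_dominant.
Qed.

End Cancellation.

Lemma schur_weight n D : (schur n D =
  \sum_(T : {ffun seq_sub D -> 'I_n} | semistandard T) 'X_[weight T])%R.
Proof.
apply: eq_bigr => T _; rewrite mprodXE; congr 'X_[_]%R; apply/mnmP => a.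
rewrite mnm_sumE mnmE /content /content_in -sum1dep_card [RHS]big_mkcond /=.
by apply: eq_bigr => b _; rewrite mnm1E -val_eqE; case: eqP.
Qed.

Lemma schur_coef_schur n D (M : 'X_{1..n}) : convex D -> dominant M ->
  schur_coef M (schur n D) =
  #|[set T : {ffun seq_sub D -> 'I_n} | lr_filling M T]|%:R%R.
Proof.
move=> D_convex M_dominant; rewrite schur_weight linear_sum /=.
under eq_bigr do rewrite schur_coef_mpolyX.
exact: sum_signed_count.
Qed.

(** * Littlewood-Richardson rule *)

Lemma count_leq_iota j m : count (leq j) (iota 0 m) = m - j.
Proof. by elim: m => // m IHm; rewrite -addn1 iotaD count_cat IHm /=; lia. Qed.

Section SkewDiagrams.

Variables (la mu : seq nat).

Lemma mem_skew_diagram i j : ((i, j) \in skew_diagram la mu) =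
  (i < size la) && (nth 0 mu i <= j < nth 0 la i).
Proof.
apply/allpairsPdep/idP => [[r [k [+ + [-> ->]]]]|ij_in].
  by rewrite !mem_iota; lia.
by exists i, j; rewrite !mem_iota; split=> //; lia.
Qed.

Lemma skew_diagram_uniq : uniq (skew_diagram la mu).
Proof.
apply: (@allpairs_uniq_dep _ (fun=> nat) _ (fun i j => (i, j))).
- exact: iota_uniq.
- by move=> ? _; exact: iota_uniq.
- by move=> [i j] [i' j'] _ _ /= [-> ->].
Qed.

Lemma skew_diagram_convex :
  (forall a b, a <= b -> nth 0 la b <= nth 0 la a) ->
  (forall a b, a <= b -> nth 0 mu b <= nth 0 mu a) ->
  convex (skew_diagram la mu).
Proof.
move=> la_anti mu_anti [r1 c1] [r2 c2] r c; rewrite !mem_skew_diagram /=.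
move=> in1 in2 /andP[r1r rr2] c_in.
by have := la_anti _ _ rr2; have := mu_anti _ _ r1r; lia.
Qed.

Lemma count_skew_diagram (p q : pred nat) :
  count (fun b => p b.1 && q b.2) (skew_diagram la mu) =
  \sum_(r <- iota 0 (size la) | p r)
     count q (iota (nth 0 mu r) (nth 0 la r - nth 0 mu r)).
Proof.
rewrite /skew_diagram count_flatten -map_comp sumnE big_map [RHS]big_mkcond /=.
apply: eq_bigr => r _; rewrite count_map /preim /=.
by case: (p r); rewrite ?count_pred0.
Qed.

End SkewDiagrams.

Lemma nth_gt0 (s : seq nat) a : 0 \notin s -> (0 < nth 0 s a) = (a < size s).
Proof.
move=> no0; have [lt_a|/(nth_default _)-> //] := ltnP a (size s).
by rewrite lt0n; apply: contraNneq no0 => <-; exact: mem_nth.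
Qed.

Lemma size_leq_sumn (s : seq nat) : 0 \notin s -> size s <= sumn s.
Proof.
elim: s => //= x s IHs; rewrite inE negb_or => /andP[x0 /IHs].
by rewrite -add1n; apply: leq_add; rewrite lt0n eq_sym.
Qed.

Section Partitions.

Variable la : seq nat.
Hypothesis la_part : is_part la.

Lemma is_part_anti a b : a <= b -> nth 0 la b <= nth 0 la a.
Proof.
case/andP: la_part => la_sorted _ ab.
have [bl|/(nth_default _)-> //] := ltnP b (size la).
apply: (sorted_leq_nth (rev_trans leq_trans) leqnn 0 la_sorted) => //.
by rewrite inE; lia.
Qed.

Lemma is_part_no0 : 0 \notin la.
Proof. by case/andP: la_part. Qed.

End Partitions.

Lemma is_part_inj la mu : is_part la -> is_part mu ->
  nth 0 la =1 nth 0 mu -> la = mu.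
Proof.
move=> la_part mu_part eq_nth; apply: (@eq_from_nth _ 0) => [|a _ //].
have size_eq a : (a < size la) = (a < size mu).
  by rewrite -!nth_gt0 ?is_part_no0 // eq_nth.
have := size_eq (size la); have := size_eq (size mu); lia.
Qed.

Definition part_mnm n (la : seq nat) : 'X_{1..n} :=
  [multinom nth 0 la a | a < n].

Lemma part_mnm_dominant n la : is_part la -> dominant (part_mnm n la).
Proof. by move=> la_part a b ab; rewrite !mnmE is_part_anti. Qed.

Lemma part_mnm_inj n la mu : is_part la -> is_part mu ->
  size la <= n -> size mu <= n -> part_mnm n la = part_mnm n mu -> la = mu.
Proof.
move=> la_part mu_part lan mun /mnmP eq_mnm; apply: is_part_inj => // a.
have [an|na] := ltnP a n; last by rewrite !nth_default ?(leq_trans _ na).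
by have := eq_mnm (Ordinal an); rewrite !mnmE.
Qed.

Section RowLattice.

Variables (D : seq (nat * nat)) (n : nat) (T : {ffun seq_sub D -> 'I_n}).
Hypotheses (D_convex : convex D) (T_ssyt : semistandard T).
Hypothesis T_lat : lattice T.

Definition content_above (k : nat) : nat -> nat :=
  content_in (fun x : seq_sub D => cell_row x < k) T.

(* The tail of columns starting at y contains every letter a + 1 of the rows up
   to that of y, but no letter a from the row of y on. *)
Lemma content_above_leftmost y a : T y = a.+1 :> nat ->
  (forall z, cell_row z = cell_row y -> T z = a.+1 :> nat ->
     cell_col y <= cell_col z) ->
  content_above (cell_row y).+1 a.+1 <= content_above (cell_row y) a.
Proof.
move=> Ty y_leftmost; have /latticeP/(_ (cell_col y))/lattice_fromP := T_lat.
move=> /(_ a) tail_lat; apply: leq_trans (leq_trans tail_lat _);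
  apply: leq_content_in => z.
- rewrite ltnS => rzy Tz; rewrite Tz eqxx andbT.
  move: rzy; rewrite leq_eqVlt => /orP[/eqP/y_leftmost|rzy]; first exact.
  rewrite leqNgt; apply/negP => /ltnW czy.
  by have := semistandard_lt D_convex T_ssyt rzy czy; rewrite Ty Tz ltnn.
- move=> cyz Tz; rewrite Tz eqxx andbT ltnNge; apply/negP => ryz.
  by have := semistandard_le D_convex T_ssyt ryz cyz; rewrite Ty Tz ltnn.
Qed.

Lemma content_above_lattice k a : content_above k.+1 a.+1 <= content_above k a.
Proof.
elim/ltn_ind: k => k IHk.
pose Q x := (cell_row x == k) && (T x == a.+1 :> nat).
have [x Qx|none] := pickP Q.
  have [y /andP[/eqP ry /eqP Ty] y_min] := @arg_minnP _ x Q (@cell_col D) Qx.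
  rewrite -ry; apply: content_above_leftmost => // z rz Tz.
  by apply: y_min; rewrite /Q rz ry Tz !eqxx.
have le_above : content_above k.+1 a.+1 <= content_above k a.+1.
  apply: leq_content_in => x; rewrite ltnS leq_eqVlt => /orP[rx|->] Tx.
    by have := none x; rewrite /Q rx Tx eqxx.
  by rewrite Tx eqxx.
apply: leq_trans le_above _; case: k IHk {Q none} => [_|k IHk].
  by rewrite /content_above content_in0.
apply: leq_trans (IHk k (ltnSn k)) _; apply: leq_content_in => x /ltnW xk ->.
by rewrite eqxx andbT.
Qed.

Lemma entry_le_row x : T x <= cell_row x.
Proof.
have none a k : k <= a -> content_above k a = 0.
  elim: a k => [|a IHa] [|k] // ka.
  - by rewrite /content_above content_in0.
  - by rewrite /content_above content_in0.
  - by apply/eqP; rewrite -leqn0 -(IHa k ka) content_above_lattice.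
rewrite leqNgt; apply/negP => /none/eqP.
by rewrite cards_eq0 => /eqP/setP/(_ x); rewrite !inE ltnSn eqxx.
Qed.

End RowLattice.

Section YoungDiagram.

Variables (n : nat) (la : seq nat).
Hypothesis la_part : is_part la.

Local Notation D := (young_diagram la).
Implicit Type T : {ffun seq_sub D -> 'I_n}.

Lemma young_convex : convex D.
Proof.
apply: skew_diagram_convex; first exact: is_part_anti.
by move=> a b _; rewrite !nth_nil.
Qed.

Lemma mem_young_diagram i j : ((i, j) \in D) = (j < nth 0 la i).
Proof.
rewrite mem_skew_diagram nth_nil /= -nth_gt0 ?is_part_no0 // andbC.
by apply: andb_idr => /(leq_ltn_trans (leq0n j)).
Qed.

Lemma row_le_entry T x : semistandard T -> cell_row x <= T x.
Proof.
case/semistandardP=> _ T_col; move: {-2}(cell_row x) (erefl (cell_row x)) => r.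
elim: r x => // r IHr [[i j] /= ij_in] ri; rewrite {1}/cell_row /= in ri.
have rj_in : (r, j) \in D.
  move: ij_in; rewrite !mem_young_diagram -ri => /leq_trans; apply.
  exact: is_part_anti.
apply: leq_ltn_trans (IHr (SeqSub rj_in) erefl) (T_col _ _ _ _) => //.
by rewrite /cell_row /= -ri.
Qed.

Lemma young_lattice_entry T x :
  semistandard T -> lattice T -> T x = cell_row x :> nat.
Proof.
move=> T_ssyt T_lat; apply/eqP; rewrite eqn_leq row_le_entry // andbT.
exact: (entry_le_row young_convex T_ssyt T_lat).
Qed.

Section RowFilling.

Variable T : {ffun seq_sub D -> 'I_n}.
Hypothesis T_row : forall x, T x = cell_row x :> nat.

Lemma row_filling_semistandard : semistandard T.
Proof. by apply/semistandardP; split=> x y; rewrite !T_row // => ->. Qed.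

Lemma content_from_row_filling j a : content_from j T a = nth 0 la a - j.
Proof.
transitivity (count (fun b => (b.1 == a) && (j <= b.2)) D).
  rewrite -(card_cells _ (skew_diagram_uniq _ _)); apply: eq_card => x.
  by rewrite !inE T_row andbC.
rewrite (count_skew_diagram _ _ (pred1 a) (leq j)).
have [al|la_a] := ltnP a (size la); last first.
  rewrite nth_default // big_seq_cond big1 // => r.
  by rewrite mem_iota => /andP[+ /eqP]; lia.
rewrite -big_filter filter_pred1_uniq ?iota_uniq ?mem_iota // big_seq1.
by rewrite nth_nil subn0 count_leq_iota.
Qed.

Lemma row_filling_lattice : lattice T.
Proof.
apply/latticeP => j; apply/lattice_fromP => a.
rewrite !content_from_row_filling; exact/leq_sub2r/is_part_anti.
Qed.

Lemma weight_row_filling : weight T = part_mnm n la.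
Proof.
apply/mnmP => a; rewrite !mnmE -[nth 0 la a]subn0 -content_from_row_filling.
exact: eq_content_in.
Qed.

End RowFilling.

Hypothesis la_n : size la <= n.

Lemma card_lr_filling_young nu : is_part nu -> size nu <= n ->
  #|[set T : {ffun seq_sub D -> 'I_n} | lr_filling (part_mnm n nu) T]| =
  (la == nu).
Proof.
move=> nu_part nu_n; case: eqP => [<-|ne]; last first.
  apply: eq_card0 => T; rewrite inE.
  apply/negP => /and3P[T_ssyt T_lat /eqP T_nu]; case: ne.
  have T_row x := young_lattice_entry x T_ssyt T_lat.
  by apply: (part_mnm_inj (n := n)); rewrite // -T_nu weight_row_filling.
have row_lt (x : seq_sub D) : cell_row x < n.
  apply: leq_trans la_n; case: x => -[i j] ij_in; rewrite /cell_row /=.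
  by move: ij_in; rewrite mem_skew_diagram => /andP[].
pose T0 : {ffun seq_sub D -> 'I_n} := [ffun x => Ordinal (row_lt x)].
have T0_row x : T0 x = cell_row x :> nat by rewrite ffunE.
apply: (@eq_card1 _ T0) => T; rewrite !inE.
apply/and3P/eqP => [[T_ssyt T_lat _]|->].
  apply/ffunP => x; apply: val_inj => /=.
  by rewrite (young_lattice_entry x T_ssyt T_lat) T0_row.
by rewrite row_filling_semistandard ?row_filling_lattice ?weight_row_filling.
Qed.

End YoungDiagram.

Lemma littlewood_richardson_rule n D c nu :
  convex D -> LR_coefficients D c -> size D <= n ->
  is_part nu -> sumn nu = size D ->
  c nu =
  #|[set T : {ffun seq_sub D -> 'I_n} | lr_filling (part_mnm n nu) T]|%:R%R.
Proof.
move=> D_convex D_LR Dn nu_part nu_sum.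
have size_n mu : is_part mu -> sumn mu = size D -> size mu <= n.
  move=> mu_part mu_sum; apply: leq_trans Dn.
  by rewrite -mu_sum size_leq_sumn ?is_part_no0.
rewrite -schur_coef_schur ?D_LR //; last exact: part_mnm_dominant.
rewrite linear_sum (bigD1_seq nu) ?uniq_partitions //=; last first.
  by rewrite mem_partitions nu_part nu_sum eqxx.
have coef_young mu : is_part mu -> sumn mu = size D ->
    schur_coef (part_mnm n nu) (schur n (young_diagram mu)) = (mu == nu)%:R%R.
  move=> mu_part mu_sum.
  rewrite schur_coef_schur ?card_lr_filling_young ?size_n //.
    exact: young_convex.
  exact: part_mnm_dominant.
rewrite linearZ /= coef_young // eqxx mulr1 big1_seq ?addr0 // => mu /andP[ne].
rewrite mem_partitions => /andP[mu_part /eqP mu_sum].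
by rewrite linearZ /= coef_young // (negbTE ne) mulr0.
Qed.

Lemma LR_coefficients_gt0 n D c nu :
  convex D -> LR_coefficients D c -> size D <= n ->
  is_part nu -> sumn nu = size D ->
  (0 < c nu)%R =
  [exists T : {ffun seq_sub D -> 'I_n}, lr_filling (part_mnm n nu) T].
Proof.
move=> D_convex D_LR Dn nu_part nu_sum.
rewrite (littlewood_richardson_rule D_convex D_LR Dn) // Num.Theory.ltr0n.
by apply/card_gt0P/existsP => -[T T_lr]; exists T; rewrite inE in T_lr *.
Qed.

(** * Levels of rows *)

Section Levels.

Variables (D : seq (nat * nat)) (n : nat) (T : {ffun seq_sub D -> 'I_n}).
Hypotheses (D_convex : convex D) (T_ssyt : semistandard T).
Variable S : pred nat.

Definition level (k : nat) : nat := count (predC S) (iota 0 k).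

Lemma levelS k : level k.+1 = level k + ~~ S k.
Proof. by rewrite /level -addn1 iotaD count_cat /= addn0. Qed.

Lemma level_const a b : a <= b -> (forall r, a <= r < b -> S r) ->
  level b = level a.
Proof.
move=> ab; rewrite -(subnK ab); elim: (b - a) => //= d IHd S_ab.
rewrite addSn levelS IHd ?S_ab ?addn0 // => [|r /andP[ar rd]]; first by lia.
by rewrite S_ab // ar ltnW.
Qed.

Definition at_level : {set seq_sub D} :=
  [set x | S (cell_row x) & T x == level (cell_row x) :> nat].

Lemma content_above_level k : lattice T ->
  content_above T k (level k) <= #|[set x in at_level | cell_row x < k]|.
Proof.
move=> T_lat; elim: k => [|k IHk]; first by rewrite /content_above content_in0.
rewrite levelS; have [Sk|nSk] := boolP (S k); rewrite ?addn0 ?addn1; last first.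
  apply: leq_trans (content_above_lattice D_convex T_ssyt T_lat _ _) _.
  apply: leq_trans IHk _; apply/subset_leq_card/subsetP => x; rewrite !inE.
  by move=> /andP[-> /ltnW].
rewrite /content_above (content_inID (fun x => cell_row x < k)).
rewrite -[leqRHS](cardsID [set x | cell_row x < k]); apply: leq_add.
  rewrite (_ : content_in _ _ _ = content_above T k (level k)).
    apply: leq_trans IHk _; apply/subset_leq_card/subsetP => x; rewrite !inE.
    by move=> /andP[-> xk]; rewrite xk ltnW.
  by apply: eq_content_in => x /=; lia.
apply/subset_leq_card/subsetP => x; rewrite !inE /= ltnS => /andP[kx Tx].
have -> : cell_row x = k by lia.
by rewrite Sk ltnn leqnn Tx.
Qed.

Lemma at_level_column x y : cell_col x = cell_col y ->
  cell_row x < cell_row y -> (forall r, cell_row x <= r <= cell_row y -> S r) ->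
  ~~ ((x \in at_level) && (y \in at_level)).
Proof.
move=> cxy rxy S_xy.
have lt_T := semistandard_lt D_convex T_ssyt rxy (eq_leq cxy).
rewrite !inE; apply/negP => /andP[/andP[_ /eqP Tx] /andP[_ /eqP Ty]].
rewrite Tx Ty (level_const (ltnW rxy)) ?ltnn // in lt_T.
by move=> r /andP[xr ry]; rewrite S_xy // xr ltnW.
Qed.

Lemma column_off_level j : uniq D ->
  1 < size (column D j) -> all (fun b => S b.1) (column D j) ->
  exists x, [/\ S (cell_row x), x \notin at_level & cell_col x = j].
Proof.
move=> D_uniq gt1 /allP S_col.
have S_row r : (r, j) \in D -> S r.
  by move=> rj_in; apply: (S_col (r, j)); rewrite mem_filter eqxx.
have S_cell (x : seq_sub D) : cell_col x = j -> S (cell_row x).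
  by move=> cx; apply: S_row; rewrite -cx -surjective_pairing (valP x).
have off_level (x y : seq_sub D) : cell_col x = j -> cell_col y = j ->
    cell_row x < cell_row y ->
    exists x, [/\ S (cell_row x), x \notin at_level & cell_col x = j].
  move=> cx cy rxy; have : ~~ ((x \in at_level) && (y \in at_level)).
    apply: at_level_column => // [|r xry]; first by rewrite cx.
    have [||z <- cz] :=
      convex_cell D_convex (x := x) (z := y) (r := r) (c := j).
    - by [].
    - by rewrite cx cy leqnn.
    - exact: S_cell.
  by case/nandP=> [nx|ny]; [exists x | exists y]; split=> //; exact: S_cell.
have : uniq (column D j) by rewrite filter_uniq.
have in_D b : b \in column D j -> b \in D /\ b.2 = j.
  by rewrite mem_filter => /andP[/eqP].
case: (column D j) gt1 in_D => [|b1 [|b2 s]] //= _ in_D /andP[+ _].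
have [[h1 c1] [h2 c2]] : (b1 \in D /\ b1.2 = j) /\ (b2 \in D /\ b2.2 = j).
  by split; apply: in_D; rewrite !inE eqxx ?orbT.
rewrite inE negb_or => /andP[ne12 _].
have [lt12|lt21|e12] := ltngtP b1.1 b2.1.
- exact: (off_level (SeqSub h1) (SeqSub h2)).
- exact: (off_level (SeqSub h2) (SeqSub h1)).
case/eqP: ne12.
by rewrite [LHS]surjective_pairing e12 c1 -c2 -surjective_pairing.
Qed.

Lemma content_level_bound N : uniq D -> lattice T ->
  (forall x : seq_sub D, cell_row x < N) ->
  content T (level N)
    + count (fun j => (1 < size (column D j))
                      && all (fun b => S b.1) (column D j))
        (undup [seq b.2 | b <- D])
  <= count (fun b => S b.1) D.
Proof.
move=> D_uniq T_lat row_lt; rewrite -(card_cells (fun b => S b.1)) //.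
rewrite -(cardsID at_level); apply: leq_add.
  have := content_above_level N T_lat.
  rewrite (_ : content_above T N _ = content T (level N)).
    move/leq_trans; apply; apply/subset_leq_card/subsetP => x; rewrite !inE.
    by move=> /andP[/andP[-> ->]].
  by apply: eq_content_in => x; rewrite row_lt.
rewrite -size_filter cardE -(size_map (@cell_col _)); apply: uniq_leq_size.
  by rewrite filter_uniq ?undup_uniq.
move=> j; rewrite mem_filter => /andP[/andP[gt1 S_col] _].
have [x [Sx Tx <-]] := column_off_level D_uniq gt1 S_col.
by apply: map_f; rewrite mem_enum inE Tx inE.
Qed.

End Levels.

(** * Ribbons *)

Section RowRanks.

Variable be : seq nat.

Definition ranked_rows : seq nat :=
  sort (fun k l => ~~ row_smaller be k l) (iota 0 (size be)).

Local Notation ranked := (nth 0 ranked_rows).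

Lemma size_ranked_rows : size ranked_rows = size be.
Proof. by rewrite size_sort size_iota. Qed.

Lemma perm_ranked_rows : perm_eq ranked_rows (iota 0 (size be)).
Proof. by rewrite perm_sort. Qed.

Lemma sorted_ranked_rows :
  sorted (fun k l => ~~ row_smaller be k l) ranked_rows.
Proof. by apply: sort_sorted => k l; rewrite /row_smaller; lia. Qed.

Lemma row_smaller_ranked p q : p < size be -> q < size be ->
  row_smaller be (ranked p) (ranked q) = (q < p).
Proof.
have ranked_anti a b : a <= b -> b < size be ->
    ~~ row_smaller be (ranked a) (ranked b).
  move=> ab bn; apply: (sorted_leq_nth _ _ 0 sorted_ranked_rows) => //.
  - by move=> l k m; rewrite /row_smaller; lia.
  - by move=> k; rewrite /row_smaller; lia.
  - by rewrite inE size_ranked_rows; lia.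
  - by rewrite inE size_ranked_rows.
move=> pn qn; have [qp|pq] := ltnP q p; last exact/negbTE/ranked_anti.
have ne : ranked q != ranked p.
  by rewrite nth_uniq ?size_ranked_rows ?sort_uniq ?iota_uniq // neq_ltn qp.
by have := ranked_anti q p (ltnW qp) pn; move: ne; rewrite /row_smaller; lia.
Qed.

Lemma among_smallest_ranked m q : q < size be ->
  among_smallest be m (ranked q) = (size be - q.+1 < m).
Proof.
move=> qn; rewrite /among_smallest -(seq.permP perm_ranked_rows); congr (_ < m).
rewrite -[X in count _ X](mkseq_nth 0) size_ranked_rows count_map.
rewrite -(count_leq_iota q.+1); apply: eq_in_count => p.
by rewrite mem_iota => pn; exact: row_smaller_ranked.
Qed.

Lemma sum_among_smallest i (F : nat -> nat) : i <= size be ->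
  \sum_(r <- iota 0 (size be) | among_smallest be (size be - i) r) F r =
  \sum_(i <= q < size be) F (ranked q).
Proof.
move=> i_n; rewrite -(perm_big _ perm_ranked_rows) /= (big_nth 0).
rewrite size_ranked_rows [RHS](big_nat_widenl _ 0) //.
rewrite [LHS]big_nat_cond [RHS]big_nat_cond; apply: eq_bigl => q.
by apply: andb_id2l => qn; rewrite among_smallest_ranked //=; lia.
Qed.

Lemma count_not_smallest i : i <= size be ->
  count (predC (among_smallest be (size be - i))) (iota 0 (size be)) = i.
Proof.
move=> i_n.
have := count_predC (among_smallest be (size be - i)) (iota 0 (size be)).
rewrite -{1}sum1_count sum_among_smallest // sum_nat_const_nat size_iota.
by lia.
Qed.

Lemma map_ranked_rows al : is_part al -> perm_eq be al ->
  map (nth 0 be) ranked_rows = al.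
Proof.
move=> /andP[al_sorted _] be_al.
apply: (sorted_eq (leT := geq)) => //.
- exact: rev_trans leq_trans.
- by move=> a b; rewrite andbC; exact: anti_leq.
- rewrite sorted_map; apply: sub_sorted sorted_ranked_rows => k l /=.
  by rewrite /row_smaller; lia.
apply: perm_trans be_al; rewrite -[X in perm_eq _ X](mkseq_nth 0).
exact: perm_map perm_ranked_rows.
Qed.

Lemma sum_smallest_rows al i : is_part al -> perm_eq be al -> i <= size be ->
  \sum_(r <- iota 0 (size be) | among_smallest be (size be - i) r) nth 0 be r =
  \sum_(i <= q < size al) nth 0 al q.
Proof.
move=> al_part be_al i_n; rewrite sum_among_smallest // -(perm_size be_al).
apply: eq_big_nat => q /andP[_ qn].
by rewrite -(map_ranked_rows al_part be_al) (nth_map 0) // size_ranked_rows.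
Qed.

End RowRanks.

Section RibbonShape.

Variable be : seq nat.
Hypothesis be_no0 : 0 \notin be.

Local Notation outer := (nth 0 (ribbon_outer be)).

Lemma size_ribbon_outer : size (ribbon_outer be) = size be.
Proof. by rewrite size_map size_iota. Qed.

Lemma nth_ribbon_outer r : r < size be ->
  outer r = sumn (drop r be) - (size be - r.+1).
Proof. by move=> rn; rewrite (nth_map 0) ?size_iota // nth_iota. Qed.

Lemma nth_ribbon_inner r : nth 0 (ribbon_inner be) r = (outer r.+1).-1.
Proof.
rewrite /ribbon_inner -nth_behead.
have [r_lt|r_ge] := ltnP r (size (behead (ribbon_outer be))).
  by rewrite (nth_map 0).
by rewrite !nth_default // size_map.
Qed.

Lemma ribbon_outer_rec r :
  r < size be -> outer r = nth 0 be r + (outer r.+1).-1.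
Proof.
move=> rn; rewrite nth_ribbon_outer // (drop_nth 0 rn) /=.
have [rn'|nr] := ltnP r.+1 (size be).
  rewrite nth_ribbon_outer //.
  have drop_no0 : 0 \notin drop r.+1 be by apply: contra be_no0 => /mem_drop.
  by have := size_leq_sumn drop_no0; rewrite size_drop; lia.
by rewrite drop_oversize //= [outer _]nth_default ?size_ribbon_outer //; lia.
Qed.

Lemma ribbon_outer_anti a b : a <= b -> outer b <= outer a.
Proof.
move=> ab; rewrite -(subnK ab); elim: (b - a) => //= d IHd; rewrite addSn.
apply: leq_trans IHd; have [rn|nr] := ltnP (d + a) (size be).
  by have := nth_gt0 (d + a) be_no0; rewrite rn (ribbon_outer_rec rn); lia.
by rewrite nth_default ?size_ribbon_outer // ltnW.
Qed.

Lemma ribbon_convex : convex (ribbon be).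
Proof.
apply: skew_diagram_convex => a b ab; first exact: ribbon_outer_anti.
by rewrite !nth_ribbon_inner -!subn1 leq_sub2r // ribbon_outer_anti.
Qed.

Lemma ribbon_row_lt (x : seq_sub (ribbon be)) : cell_row x < size be.
Proof.
case: x => -[r c] rc_in; rewrite /cell_row /=; move: rc_in.
by rewrite mem_skew_diagram size_ribbon_outer => /andP[].
Qed.

Lemma count_ribbon_rows (p : pred nat) :
  count (fun b => p b.1) (ribbon be) =
  \sum_(r <- iota 0 (size be) | p r) nth 0 be r.
Proof.
under eq_count do rewrite -[p _]andbT.
rewrite (count_skew_diagram _ _ p predT) size_ribbon_outer.
rewrite big_seq_cond [RHS]big_seq_cond.
apply: eq_bigr => r; rewrite mem_iota count_predT size_iota => /andP[rn _].
by rewrite nth_ribbon_inner ribbon_outer_rec // addnK.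
Qed.

Lemma size_ribbon : size (ribbon be) = sumn be.
Proof.
rewrite -count_predT (count_ribbon_rows xpredT) sumnE.
by rewrite [RHS](big_nth 0) /index_iota subn0.
Qed.

Lemma size_overlapping_partition : size (overlapping_partition be) = size be.
Proof. by rewrite size_map size_iota. Qed.

Lemma lattice_ribbon_bound n (T : {ffun seq_sub (ribbon be) -> 'I_n}) i :
  semistandard T -> lattice T -> i < size be ->
  content T i + nth 0 (overlapping_partition be) i <=
  \sum_(r <- iota 0 (size be) | among_smallest be (size be - i) r) nth 0 be r.
Proof.
move=> T_ssyt T_lat i_n; set S := among_smallest be (size be - i).
have := content_level_bound ribbon_convex T_ssyt S (skew_diagram_uniq _ _)
  T_lat ribbon_row_lt.
rewrite /level count_not_smallest ?(ltnW i_n) // -count_ribbon_rows.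
apply: leq_trans; rewrite leq_add2l.
rewrite (nth_map 0) ?size_iota // nth_iota // add0n.
by apply: sub_count => j /= /andP[/eqP->].
Qed.

End RibbonShape.

Lemma perm_rearrange al (pi : 'S_(size al)) : perm_eq (rearrange al pi) al.
Proof.
pose entry (i : 'I_(size al)) := nth 0 al i.
have entries : map entry (enum 'I_(size al)) = al.
  by rewrite -[RHS](mkseq_nth 0) /mkseq -val_enum_ord -map_comp.
rewrite /rearrange (map_comp entry pi) -[X in perm_eq _ X]entries.
apply/perm_map/uniq_perm; rewrite ?enum_uniq //.
  by rewrite map_inj_uniq ?enum_uniq //; exact: perm_inj.
move=> i; rewrite mem_enum; apply/mapP; exists (pi^-1%g i).
  by rewrite mem_enum.
by rewrite permKV.
Qed.

Theorem theorem7p1 (al : seq nat) (al_part : is_part al)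
    (al_ge2 : forall x : nat, x \in al -> 2 <= x)
    (pi : 'S_(size al)) (c : seq nat -> int)
    (c_LR : LR_coefficients (ribbon (rearrange al pi)) c)
    (nu : seq nat)
    (nu_interval : dom_interval al
       [:: sumn al - size al + 1; size al - 1] nu)
    (c_gt0 : (0 < c nu)%R) (i : nat)
    (i_lt : i < plength (overlapping_partition (rearrange al pi))) :
  ((nth 0%N nu i)%:Z
   <= (\sum_(i <= q < size al) nth 0%N al q)%N%:Z
      - (nth 0%N (overlapping_partition (rearrange al pi)) i)%:Z)%R.
Proof.
have be_al := perm_rearrange pi; set be := rearrange al pi in c_LR i_lt be_al *.
have be_no0 : 0 \notin be by rewrite (perm_mem be_al) is_part_no0.
have i_n : i < size be.
  by rewrite -size_overlapping_partition (leq_trans i_lt) ?count_size.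
have [nu_part [nu_sum _] _] := nu_interval.
have ribbon_size : size (ribbon be) = sumn al.
  by rewrite size_ribbon ?(perm_sumn be_al).
move: c_gt0.
rewrite (LR_coefficients_gt0 (ribbon_convex be_no0) c_LR (leqnn _)) //;
  last by rewrite ribbon_size nu_sum.
case/existsP=> T /and3P[T_ssyt T_lat /eqP/mnmP T_nu].
have i_ribbon : i < size (ribbon be).
  rewrite ribbon_size (leq_trans i_n) // (perm_size be_al).
  by rewrite size_leq_sumn ?is_part_no0.
have := lattice_ribbon_bound be_no0 T_ssyt T_lat i_n.
have := T_nu (Ordinal i_ribbon); rewrite !mnmE /= => ->.
by rewrite (sum_smallest_rows al_part be_al (ltnW i_n)); lia.
Qed.
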